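(* Let $G$ be either $(\mathbb N,+)$ or $(\mathbb N,\times)$ and let $(F_n)$ be an arbitrary F{\o}lner sequence in $G$. Then the set of $(F_n)$-normal numbers in $[0,1]$ (i.e., numbers which have $(F_n)$-normal binary expansions) is of first category.
   Context: $\mathbb N=\{1,2,\dots\}$. Write $*$ for the operation of $G$ ($+$ or $\times$). A sequence $(F_n)$ of (nonempty) finite subsets of $\mathbb N$ is a F{\o}lner sequence in $G$ if for every $g\in\mathbb N$, $\lim_n\frac1{|F_n|}|\{h\in F_n: g*h\in F_n\}|=1$. For nonempty finite $K\subset\mathbb N$, $B\in\{0,1\}^K$ and $x\in\{0,1\}^{\mathbb N}$ put $\mathsf N(B,x,F_n)=|\{g\in\mathbb N\cup\{e\}:(\forall h\in K)\ h*g\in F_n\text{ and }x_{h*g}=B(h)\}|$, where $e$ is the identity ($e=0$ for $+$, $e=1$ for $\times$). A sequence $x\in\{0,1\}^{\mathbb N}$ is $(F_n)$-normal if $\lim_n\frac1{|F_n|}\mathsf N(B,x,F_n)=2^{-|K|}$ for all such $K,B$. The sequence $(x_n)\in\{0,1\}^{\mathbb N}$ is a binary expansion of the number $\sum_{n\ge1}x_n2^{-n}\in[0,1]$. *)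

(* Defs.v *)
From HB Require Import structures.
From mathcomp Require Import all_boot all_order all_algebra finmap.
From mathcomp Require Import all_classical all_reals all_analysis.
Set Implicit Arguments.
Unset Strict Implicit.
Unset Printing Implicit Defensive.
Import Order.TTheory GRing.Theory Num.Theory.
Import numFieldNormedType.Exports.
Local Open Scope fset_scope.
Local Open Scope classical_set_scope.
Local Open Scope ring_scope.

(* The set {1, 2, ...} is carried by [nat]: its elements are the g with
   [(0 < g)%N], its finite subsets are the [A : {fset nat}] with [0 \notin A],
   and a sequence indexed by it is an [x : nat -> bool] whose value at 0 is
   irrelevant. *)

Variant nat_semigroup := NatAdd | NatMul.

Definition sgop (G : nat_semigroup) : nat -> nat -> nat :=
  match G with NatAdd => addn | NatMul => muln end.

Definition sgid (G : nat_semigroup) : nat :=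
  match G with NatAdd => 0 | NatMul => 1 end.

Definition is_Folner (R : realType) (G : nat_semigroup) (F : nat -> {fset nat})
    : Prop :=
  (forall n, F n != fset0 /\ 0%N \notin F n) /\
  forall g : nat, (0 < g)%N ->
    (#|` [fset h in F n | sgop G g h \in F n]|%:R / #|` F n|%:R : R)
      @[n --> \oo] --> (1 : R).

Definition occurrences (G : nat_semigroup) (K : {fset nat})
    (B : {ffun K -> bool}) (x : nat -> bool) (A : {fset nat}) : set nat :=
  [set g | ((0 < g)%N \/ g = sgid G) /\
           forall h : K, sgop G (val h) g \in A /\ x (sgop G (val h) g) = B h].

(* [fset_set] is a junk value on infinite sets, so [nocc] below is the intended
   cardinality only because of this lemma. *)
Lemma finite_occurrences (G : nat_semigroup) (K : {fset nat})
    (B : {ffun K -> bool}) (x : nat -> bool) (A : {fset nat}) :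
  K != fset0 -> 0%N \notin K -> finite_set (occurrences G B x A).
Proof.
move=> /fset0Pn[h hK] K0.
have h0 : (0 < h)%N by rewrite lt0n; apply: contraNneq K0 => <-.
apply: (@sub_finite_set _ _ `I_(\max_(a <- A) a).+1); last exact: finite_II.
move=> g [_ /(_ [` hK])[/= hgA _]] /=; rewrite ltnS.
apply: (@leq_trans (sgop G h g)).
  by case: G {hgA} => /=; [exact: leq_addl|exact: leq_pmull].
exact: (@leq_bigmax_seq _ _ xpredT id _ hgA).
Qed.

Definition nocc (G : nat_semigroup) (K : {fset nat}) (B : {ffun K -> bool})
    (x : nat -> bool) (A : {fset nat}) : nat :=
  #|` fset_set (occurrences G B x A)|.

Definition normal_seq (R : realType) (G : nat_semigroup)
    (F : nat -> {fset nat}) (x : nat -> bool) : Prop :=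
  forall (K : {fset nat}) (B : {ffun K -> bool}),
    K != fset0 -> 0%N \notin K ->
    ((nocc G B x (F n))%:R / #|` F n|%:R : R)
      @[n --> \oo] --> (2 ^- #|` K| : R).

Definition binary_expansion (R : realType) (x : nat -> bool) (r : R) : Prop :=
  (\sum_(1 <= k < n.+1) (x k)%:R * 2 ^- k : R) @[n --> \oo] --> r.

(* The type of points of [0, 1], with the topology induced from [R]. *)
Definition unit_interval (R : realType) : topologicalType :=
  Topological.clone (set_type (`[0, 1]%classic : set R)) _.

Definition normal_number (R : realType) (G : nat_semigroup)
    (F : nat -> {fset nat}) : set (unit_interval R) :=
  [set r | exists x : nat -> bool,
     binary_expansion x (set_val r : R) /\ normal_seq R G F x].

Definition nowhere_dense (T : topologicalType) (A : set T) : Prop :=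
  interior (closure A) = set0.

Definition first_category (T : topologicalType) (A : set T) : Prop :=
  exists E : nat -> set T,
    (forall n, nowhere_dense (E n)) /\ A = \bigcup_n E n.

(* Main.v *)
Require Import Defs.
From mathcomp Require Import all_boot all_order all_algebra finmap.
From mathcomp Require Import all_classical all_reals all_analysis.
From mathcomp Require Import lra zify.

(** A number r which lies just to the left of a dyadic rational a / 2^m has
    only ones at the ranks m+1, ..., M of all its binary expansions, with M as
    large as one likes if r is close enough to a / 2^m
    ([digits_left_of_dyadic]).  Such r form an open interval having a / 2^m as
    an endpoint, and dyadic rationals are dense in [0, 1].

    On the other hand, normality for the one-point pattern K = {1}, B(1) = 1
    says that the ones of x have density 1/2 along the Folner sequence
    ([nocc_singleton]).  So a normal number belongs, for some N, to the set E_N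
    of numbers with a normal expansion whose ones fill less than 3/4 of F_n for
    every n >= N, and it suffices that each E_N be nowhere dense.  The
    cardinalities of the sets F_n tend to infinity ([Folner_card_gt]).
    Hence, given a / 2^m, there is n >= N for which F_n has more than 4m
    elements.  At most m of them are in {1, ..., m}, so an expansion with only
    ones at the ranks m+1, ..., max F_n has ones on more than 3/4 of F_n, and a
    number all of whose expansions are of this kind escapes E_N.  Thus next to
    every dyadic rational there is an interval that E_N misses, and E_N is
    nowhere dense ([nowhere_dense_left_of_dyadics]). *)

Import Order.TTheory GRing.Theory Num.Theory.
Import numFieldNormedType.Exports.
Local Open Scope fset_scope.
Local Open Scope classical_set_scope.
Local Open Scope ring_scope.

(** * Binary digits to the left of a dyadic rational *)

Section BinaryDigits.
Context {R : realType}.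
Implicit Types (x : nat -> bool) (r : R).

Definition digit_sum x n : R := \sum_(1 <= k < n.+1) (x k)%:R * 2 ^- k.

Lemma digit_sumS x n :
  digit_sum x n.+1 = digit_sum x n + (x n.+1)%:R * 2 ^- n.+1.
Proof. by rewrite /digit_sum big_nat_recr. Qed.

Lemma digit_sum_dyadic x n : exists t : nat, digit_sum x n = t%:R / 2 ^+ n.
Proof.
elim: n => [|n [t IH]].
  by exists 0%N; rewrite /digit_sum big_nil mul0r.
exists (t * 2 + x n.+1)%N; rewrite digit_sumS IH natrD mulrDl natrM.
by congr (_ + _); rewrite exprS invfM mulrA mulfK// pnatr_eq0.
Qed.

Lemma half_expS n : 2 ^- n = 2 ^- n.+1 + 2 ^- n.+1 :> R.
Proof. by rewrite exprS invfM; lra. Qed.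

Lemma digit_sum_add x n k :
  digit_sum x n <= digit_sum x (n + k) <= digit_sum x n + 2 ^- n - 2 ^- (n + k).
Proof.
elim: k => [|k /andP[IH1 IH2]].
  by rewrite addn0 lexx addrK lexx.
rewrite addnS digit_sumS.
have h := half_expS (n + k).
have p : 0 < 2 ^- (n + k).+1 :> R by rewrite invr_gt0 exprn_gt0.
by case: (x _) => /=; rewrite ?mul1r ?mul0r; apply/andP; split; lra.
Qed.

Lemma binary_expansion_bounds x r n : binary_expansion x r ->
  digit_sum x n <= r <= digit_sum x n + 2 ^- n.
Proof.
move=> xr.
apply/andP; split.
  apply: (cvgr_to_ge xr).
  near=> j.
  have nj : (n <= j)%N by near: j; exact: nbhs_infty_ge.
  by have /andP[] := digit_sum_add x n (j - n); rewrite subnKC.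
apply: (cvgr_to_le xr).
near=> j.
have nj : (n <= j)%N by near: j; exact: nbhs_infty_ge.
have /andP[_] := digit_sum_add x n (j - n); rewrite subnKC// => h.
apply: le_trans h _; rewrite gerBl//.
Unshelve. all: by end_near.
Qed.

(** If x_j = 0, then the partial sums of rank j - 1 and j agree, and both this
    sum and a / 2^m are multiples of 2^(1-j).  The first one being smaller, it
    is at most a / 2^m - 2^(1-j), and the remaining digits contribute at most
    2^-j, half of the gap. *)
Lemma digits_left_of_dyadic x r (a m M j : nat) : binary_expansion x r ->
  (a%:R / 2 ^+ m - 2 ^- M < r < a%:R / 2 ^+ m) -> (m < j <= M)%N -> x j.
Proof.
move=> xr /andP[r1 r2]; case: j => // j /andP[mj jM].
apply/negPn/negP => /negbTE xj.
have /andP[S1 S2] := binary_expansion_bounds x r j.+1 xr.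
rewrite digit_sumS xj mul0r addr0 in S1 S2.
have [t St] := digit_sum_dyadic x j.
have p2 k : 0 < 2 ^+ k :> R by rewrite exprn_gt0.
have am : a%:R / 2 ^+ m = (a * 2 ^ (j - m))%N%:R / 2 ^+ j :> R.
  rewrite -[in RHS](subnKC (m := m) (n := j))// natrM natrX exprD.
  by rewrite addKn invfM mulrACA divff ?mulr1// lt0r_neq0.
have tb : (t < a * 2 ^ (j - m))%N.
  rewrite -(ltr_nat R) -(ltr_pM2r (x := 2 ^- j)) ?invr_gt0// -St -am.
  exact: le_lt_trans S1 r2.
have {tb} : digit_sum x j + 2 ^- j <= a%:R / 2 ^+ m.
  have -> : digit_sum x j + 2 ^- j = t.+1%:R / 2 ^+ j.
    by rewrite St -[t.+1%:R]natr1 mulrDl mul1r.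
  by rewrite am ler_pM2r ?invr_gt0// ler_nat.
have := half_expS j.
have : 2 ^- M <= 2 ^- j.+1 :> R.
  by rewrite lef_pV2 ?posrE// ler_eXn2l// ltr1n.
lra.
Qed.

End BinaryDigits.

(** * Nowhere dense subsets of the unit interval *)

Lemma dyadic_near {R : realType} (p e : R) : 0 <= p <= 1 -> 0 < e ->
  exists m a : nat, (0 < a <= 2 ^ m)%N /\ `|p - a%:R / 2 ^+ m| < e.
Proof.
move=> /andP[p0 p1] e0.
have [/eqP ->|pn1] := boolP (p == 1).
  by exists 0%N, 1%N; rewrite expr0 divr1 subrr normr0.
have {pn1} p1 : p < 1 by rewrite lt_neqAle pn1.
have [m me] : exists m, 1 / 2 ^+ m < e.
  have [m _ me] := near_infty_natSinv_expn_lt (PosNum e0).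
  by exists m; exact: me (leqnn m).
have m0 : 0 < 2 ^+ m :> R by rewrite exprn_gt0.
have pm0 : 0 <= p * 2 ^+ m by rewrite mulr_ge0// ltW.
have /andP[t1 t2] := truncn_itv pm0.
(* Rounding upwards keeps the numerator positive, also when p = 0. *)
exists m, (Num.trunc (p * 2 ^+ m)).+1; split.
  by rewrite /= truncn_lt_nat// natrX gtr_pMl.
rewrite -[X in _ < X]natr1 in t2.
rewrite -[X in `|X - _|](mulfK (x := 2 ^+ m)) ?gt_eqF// -mulrBl normrM [X in _ * X]gtr0_norm ?invr_gt0//.
apply: le_lt_trans me; rewrite ler_pM2r ?invr_gt0//.
by rewrite -[_.+1%:R]natr1 ler_norml; apply/andP; split; lra.
Qed.

(** The interval avoided by E near a / 2^m has a / 2^m only as an endpoint;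
    this is enough, because an open set that contains a / 2^m overlaps the
    interval, and every nonempty open set contains such a point. *)
Lemma nowhere_dense_left_of_dyadics {R : realType} (E : set (unit_interval R)) :
  (forall m a : nat, (0 < a <= 2 ^ m)%N -> exists2 M : nat, (m <= M)%N &
     forall r, E r ->
       ~ (a%:R / 2 ^+ m - 2 ^- M < (set_val r : R) < a%:R / 2 ^+ m)) ->
  nowhere_dense E.
Proof.
move=> avoid; rewrite /nowhere_dense -subset0 => p pE.
have [B oB BE] : open (closure E)° by exact: open_interior.
have pB : B (set_val p) by move: pE; rewrite -BE.
have [e /= e0 eB] : nbhs_ball (set_val p) B by apply/nbhs_ballP/open_nbhs_nbhs.
have p01 : 0 <= (set_val p : R) <= 1 by have := set_valP p; rewrite /= in_itv.
have [m [a [a01 pq]]] := dyadic_near _ _ p01 e0.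
set q : R := a%:R / 2 ^+ m in pq.
(* q itself lies in B, but may be 1; a point z = q - c of both B and the interval
   to the left of q is sought. *)
have [M mM EM] := avoid _ _ a01.
have [d /= d0 dB] : nbhs_ball q B.
  by apply/nbhs_ballP/open_nbhs_nbhs; split => //; exact: eB.
have p2 k : 0 < 2 ^- k :> R by rewrite invr_gt0 exprn_gt0.
have q0 : 2 ^- M <= q.
  apply: (@le_trans _ _ (2 ^- m)).
    by rewrite lef_pV2 ?posrE ?exprn_gt0// ler_eXn2l// ltr1n.
  by apply: ler_peMl; [exact: ltW|rewrite ler1n; case/andP: a01].
have q1 : q <= 1.
  by rewrite ler_pdivrMr ?exprn_gt0// mul1r -natrX ler_nat; case/andP: a01.
pose c := Num.min (2 ^- M) d / 2.
have c0 : 0 < c by rewrite divr_gt0// lt_min p2.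
have cM : c < 2 ^- M.
  have : Num.min (2 ^- M) d <= 2 ^- M by rewrite ge_min lexx.
  by have := p2 M; rewrite /c; lra.
have cd : c < d.
  have : Num.min (2 ^- M) d <= d by rewrite ge_min lexx orbT.
  by rewrite /c; lra.
have z01 : q - c \in `[0, 1]%classic by rewrite inE /= in_itv /=; lra.
pose z : unit_interval R := exist _ (q - c) z01.
have zE : closure E z.
  apply: interior_subset; rewrite -BE; apply: dB.
  by rewrite /ball /= opprB addrC subrK gtr0_norm.
pose I : set R := `]q - 2 ^- M, q[%classic.
have [r [Er]] : E `&` (set_val @^-1` I : set (unit_interval R)) !=set0.
  apply: zE; apply: open_nbhs_nbhs; split.
    by exists I => //; exact: interval_open.
  by rewrite /I /= in_itv /= -[set_val z]/(q - c); lra.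
by rewrite /I /= in_itv; exact: EM.
Qed.

(** * Density of ones along a Folner sequence *)

(** Multiplying or adding by 2 moves the greatest element of a finite set out
    of it, so a set with at most C elements loses a fraction at least 1/C
    under this translation. *)
Lemma Folner_card_gt (R : realType) (G : nat_semigroup)
    (F : nat -> {fset nat}) (C : nat) : is_Folner R G F ->
  \forall n \near \oo, (C < #|` F n|)%N.
Proof.
move=> [F0 /(_ 2%N isT) F2].
have C1 : 1 - C.+1%:R^-1 < 1 :> R by rewrite gtrBl invr_gt0.
apply: filterS (cvgr_gt _ F2 _ C1) => n.
have [/fset0Pn[h0 h0F] n0] := F0 n.
have [h hF hmax] : exists2 h, h \in F n & forall k, k \in F n -> (k <= h)%N.
  case: (@arg_maxnP (F n) [` h0F] xpredT val) => // h _ hmax.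
  by exists (val h); [exact: valP | move=> k kF; exact: (hmax [` kF])].
set S := [fset _ in _ | _].
have SF : (#|` S| < #|` F n|)%N.
  have -> : #|` F n| = #|` (F n `\ h)%fset|.+1 by rewrite (cardfsD1 h) hF.
  rewrite ltnS; apply: fsubset_leq_card; apply/fsubsetP => k.
  rewrite !inE => /andP[-> kF]; rewrite andbT; apply: contraTneq kF => ->.
  apply/negP => /hmax; have : h != 0%N by apply: contraNneq n0 => <-.
  by case: G {F2 S} => /=; lia.
have Fn0 : 0 < #|` F n|%:R :> R by rewrite ltr0n (leq_ltn_trans _ SF).
move=> H; rewrite ltnNge; apply/negP => FC; move: H; apply/negP; rewrite -leNgt.
apply: (@le_trans _ _ (1 - #|` F n|%:R^-1)).
  rewrite ler_pdivrMr// mulrBl mul1r mulVf ?gt_eqF// lerBrDr natr1 ler_nat.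
  exact: SF.
by rewrite lerD2l lerN2 lef_pV2 ?posrE// ler_nat; apply: leqW.
Qed.

(** The map sending g to 1 * g is a bijection from the positive integers together
    with the identity onto the positive integers: for addition it is because g = 0 is allowed
    that the position 1 is reached. *)
Lemma nocc_singleton (G : nat_semigroup) (x : nat -> bool) (A : {fset nat}) :
  0%N \notin A ->
  nocc G [ffun _ : [fset 1%N] => true] x A = #|` [fset h in A | x h]|.
Proof.
move=> A0; rewrite /nocc.
set B := [ffun _ => _]; set O := occurrences _ _ _ _.
have fO : finite_set O.
  apply: finite_occurrences; rewrite ?inE//.
  by apply/fset0Pn; exists 1%N; rewrite inE.
have inj : injective (sgop G 1) by case: (G) => /= m n; lia.
have OE : sgop G 1 @` O = [set` [fset h in A | x h]].
  apply/seteqP; split => h /=.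
    move=> [g [_ /(_ [` fset11 1%N])]]; rewrite ffunE /= => -[gA xg] <-.
    by rewrite !inE gA xg.
  rewrite !inE => /andP[hA xh].
  have h0 : h != 0%N by apply: contraNneq A0 => <-.
  have [g g0 gh] : exists2 g, (0 < g)%N \/ g = sgid G & sgop G 1 g = h.
    by case: (G) => /=; [exists h.-1|exists h]; lia.
  exists g => //; split => // k; rewrite ffunE.
  by have := valP k; rewrite inE => /eqP ->; rewrite gh.
rewrite -[in RHS](set_fsetK [fset h in A | x h]) -OE fset_set_image//.
by rewrite card_imfset.
Qed.

Lemma normal_seq_ones {R : realType} {G : nat_semigroup} {F : nat -> {fset nat}}
    {x : nat -> bool} : is_Folner R G F -> normal_seq R G F x ->
  \forall n \near \oo, (4 * #|` [fset h in F n | x h]| < 3 * #|` F n|)%N.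
Proof.
move=> [F0 _] /(_ [fset 1%N] [ffun => true]).
have K0 : [fset 1%N] != fset0 by apply/fset0Pn; exists 1%N; rewrite inE.
move=> /(_ K0); rewrite inE => /(_ isT); rewrite cardfs1 expr1 => xn.
have h34 : 2^-1 < 3 / 4 :> R by lra.
apply: filterS (cvgr_lt _ xn _ h34) => n.
have [Fn0 n0] := F0 n.
rewrite nocc_singleton// ltr_pdivrMr ?ltr0n ?cardfs_gt0//.
rewrite mulrAC ltr_pdivlMr// -!natrM ltr_nat; lia.
Qed.

Theorem corollary4p8 (R : realType) (G : nat_semigroup)
    (F : nat -> {fset nat}) (hF : is_Folner R G F) :
  first_category (@normal_number R G F).
Proof.
(* A first category set is by definition exactly a union of nowhere dense sets,
   hence the normality of x inside E N. *)
pose E N : set (unit_interval R) := [set r | exists x : nat -> bool,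
  [/\ binary_expansion x (set_val r : R), normal_seq R G F x &
   forall n, (N <= n)%N -> (4 * #|` [fset h in F n | x h]| < 3 * #|` F n|)%N]].
exists E; split; last first.
  apply/seteqP; split => [r [x [xr xn]]|r [N _ [x [xr xn _]]]]; last by exists x.
  have [N _ EN] := normal_seq_ones hF xn.
  by exists N => //; exists x; split.
move=> N; apply: nowhere_dense_left_of_dyadics => m a _.
have [n0 _ big] := Folner_card_gt R G F (4 * m) hF.
pose n := maxn N n0.
have {big} Fbig : (4 * m < #|` F n|)%N by apply: big; exact: leq_maxr.
pose M := maxn m (\max_(k <- F n) k).
exists M; first exact: leq_maxl.
move=> r [x [xr _ /(_ n (leq_maxl _ _)) few]] rq.
have Fm : (#|` F n| <= #|` [fset h in F n | x h]| + m)%N.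
  have -> : m = #|` [fset k in iota 1 m]|.
    by rewrite card_fseq undup_id ?iota_uniq// size_iota.
  apply: leq_trans (fsubset_leq_card _) _; last first.
    by rewrite -cardfsUI; exact: leq_addr.
  apply/fsubsetP => k kF; rewrite !inE kF mem_iota /=.
  have k0 : k != 0%N by apply: contraNneq (hF.1 n).2 => <-.
  have [km|mk] := leqP k m; first by apply/orP; right; lia.
  rewrite (digits_left_of_dyadic _ _ _ _ M _ xr rq)// mk leq_max.
  by rewrite (@leq_bigmax_seq _ _ xpredT id _ kF) ?orbT.
lia.
Qed.
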